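(* Let $H$ be a graph. Then $\#\mathrm{LSHom}(H)\le\#\mathrm{LHom}(H)$.
   Context: Graphs are finite, undirected, possibly with loops; irreflexive means no loops. A homomorphism $h:V(G)\to V(H)$ maps each edge of $G$ to an edge of $H$; it is surjective if every vertex of $H$ is an image. $\#\mathrm{LHom}(H)$: given an irreflexive graph $G$ and lists $S_v\subseteq V(H)$ for $v\in V(G)$, output the number of homomorphisms $h$ from $G$ to $H$ with $h(v)\in S_v$ for all $v$. $\#\mathrm{LSHom}(H)$: the same input; output the number of such homomorphisms that are moreover surjective. $P_1\le P_2$ denotes a polynomial-time Turing reduction. *)

(* Defs.v *)
From HB Require Import structures.
From mathcomp Require Import all_boot all_order all_algebra.

Set Implicit Arguments.
Unset Strict Implicit.
Unset Printing Implicit Defensive.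

(** * Graphs and list homomorphisms *)

Record graph := Graph {
  vertex :> finType;
  adj : rel vertex;
  adj_sym : symmetric adj
}.

Definition is_hom (G H : graph) (h : G -> H) : bool :=
  [forall u, forall v, adj u v ==> adj (h u) (h v)].

Definition respects (G H : graph) (S : G -> {set H}) (h : G -> H) : bool :=
  [forall v, h v \in S v].

Definition surjectiveb (G H : graph) (h : G -> H) : bool :=
  [forall z, exists v, h v == z].

Record list_instance (H : graph) := ListInstance {
  inst_graph : graph;
  inst_irrefl : irreflexive (@adj inst_graph);
  inst_list : inst_graph -> {set H}
}.

Definition num_list_hom (H : graph) (x : list_instance H) : nat :=
  #|[set h : {ffun inst_graph x -> H} |
      is_hom h && respects (@inst_list H x) h]|.

Definition num_list_surj_hom (H : graph) (x : list_instance H) : nat :=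
  #|[set h : {ffun inst_graph x -> H} |
      [&& is_hom h, respects (@inst_list H x) h & surjectiveb h]]|.

(** * Encodings as bit strings *)

(* Least significant bit first, without superfluous zeros; 0 is the empty
   string. *)
Fixpoint binary_rec (fuel n : nat) : seq bool :=
  if fuel is fuel'.+1 then
    if n == 0 then [::] else odd n :: binary_rec fuel' n./2
  else [::].

Definition binary (n : nat) : seq bool := binary_rec n n.

Lemma binaryK n : foldr (fun (b : bool) m => b + m.*2) 0 (binary n) = n.
Proof.
rewrite /binary; move: {1 4 5}n (leqnn n) => m.
elim: n m => [|k IH] m; first by rewrite leqn0 => /eqP ->.
case: m => [//|m lemk] /=.
rewrite -[uphalf m]/(m.+1./2) -[~~ odd m]/(odd m.+1) IH ?odd_double_half //.
by rewrite -ltnS (leq_trans _ lemk) // -divn2 ltn_Pdiv.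
Qed.

(* Every bit is preceded by the flag 1 and the end of the string is marked
   by the flag 0. *)
Definition self_delimit (s : seq bool) : seq bool :=
  flatten [seq [:: true; b] | b <- s] ++ [:: false].

(* For each vertex v of G: the row of v in the adjacency matrix of G, and the
   characteristic vector of the list of v, which always has length #|H|.  The
   vertices are taken in the order of [enum]. *)
Definition inst_code (H : graph) (x : list_instance H) : seq bool :=
  flatten [seq self_delimit [seq adj v w | w <- enum (inst_graph x)]
               ++ [seq z \in inst_list v | z <- enum H]
          | v <- enum (inst_graph x)].

Record counting_problem := CountingProblem {
  instance : Type;
  encode : instance -> seq bool;
  answer : instance -> nat
}.

Definition LHom (H : graph) : counting_problem :=
  CountingProblem (@inst_code H) (@num_list_hom H).

Definition LSHom (H : graph) : counting_problem :=
  CountingProblem (@inst_code H) (@num_list_surj_hom H).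

(** * Oracle Turing machines *)

(* [None] is the blank. *)
Definition cell := option bool.

(* A two-way infinite tape: [tright] starts with the scanned cell, [tleft] is
   the part on the left of it, nearest cell first; all cells not listed are
   blank. *)
Record tape := Tape { tleft : seq cell; tright : seq cell }.

Definition tape_of (s : seq bool) : tape := Tape [::] (map Some s).

(* The non-blank symbols of the tape, from left to right. *)
Definition contents (t : tape) : seq bool := pmap id (rev (tleft t) ++ tright t).

Definition tread (t : tape) : cell := head None (tright t).

Definition twrite (a : cell) (t : tape) : tape :=
  Tape (tleft t) (a :: behead (tright t)).

Inductive move := MoveLeft | MoveRight | Stay.

Definition tmove (m : move) (t : tape) : tape :=
  match m with
  | MoveLeft => Tape (behead (tleft t)) (head None (tleft t) :: tright t)
  | MoveRight => Tape (tread t :: tleft t) (behead (tright t))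
  | Stay => t
  end.

(* A deterministic machine with finitely many tapes.  A state q with
   [om_query q = Some q'] is a query state: the contents of the oracle tape are
   replaced in one step by the answer of the oracle, and the next state is q'. *)
Record oracle_machine := OracleMachine {
  om_tape : finType;
  om_input : om_tape;
  om_output : om_tape;
  om_oracle : om_tape;
  om_state : finType;
  om_start : om_state;
  om_halt : pred om_state;
  om_query : om_state -> option om_state;
  om_trans : om_state -> {ffun om_tape -> cell} ->
             om_state * {ffun om_tape -> cell * move}
}.

Record config (M : oracle_machine) := Config {
  cstate : om_state M;
  ctapes : {ffun om_tape M -> tape}
}.

Definition init (M : oracle_machine) (s : seq bool) : config M :=
  Config (om_start M)
    [ffun i => if i == om_input M then tape_of s else tape_of [::]].

Definition step (M : oracle_machine) (f : seq bool -> seq bool) (c : config M) :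
    config M :=
  let q := cstate c in
  let ts := ctapes c in
  if om_halt q then c
  else if om_query q is Some q' then
    Config q' [ffun i => if i == om_oracle M
                         then tape_of (f (contents (ts i))) else ts i]
  else
    let: (q', act) := om_trans q [ffun i => tread (ts i)] in
    Config q' [ffun i => tmove (act i).2 (twrite (act i).1 (ts i))].

(* Since halting configurations are fixed by [step], this says that M halts
   after at most n steps. *)
Definition outputs_within (M : oracle_machine) (f : seq bool -> seq bool)
    (n : nat) (s r : seq bool) : Prop :=
  let c := iter n (step f) (init M s) in
  om_halt (cstate c) /\ contents (ctapes c (om_output M)) = r.

(** * Polynomial-time Turing reductions *)

(* The values of f on strings that do not encode an instance are arbitrary. *)
Definition solves (f : seq bool -> seq bool) (P : counting_problem) : Prop :=
  forall x : instance P, f (encode x) = binary (answer x).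

Definition turing_reducible (P1 P2 : counting_problem) : Prop :=
  exists (M : oracle_machine) (p : {poly nat}),
  forall f : seq bool -> seq bool, solves f P2 ->
  forall x : instance P1,
    outputs_within M f (p.[size (encode x)])%R (encode x) (binary (answer x)).

Notation "P1 <=T P2" := (turing_reducible P1 P2) (at level 70).

(** * The answer is determined by the code of the instance *)

(* Hence [solves f (LHom H)] is satisfiable, although [inst_code] identifies
   instances that differ by an order-preserving renaming of the vertices. *)

Lemma self_delimit_inj s1 s2 t1 t2 :
  self_delimit s1 ++ t1 = self_delimit s2 ++ t2 -> s1 = s2 /\ t1 = t2.
Proof.
elim: s1 s2 => [|b1 s1 IH] [|b2 s2] //=; first by case.
by case=> -> /IH[-> ->].
Qed.

Lemma blocks_inj q (B1 B2 : seq (seq bool * seq bool)) :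
  all (fun b => size b.2 == q) B1 -> all (fun b => size b.2 == q) B2 ->
  flatten [seq self_delimit b.1 ++ b.2 | b <- B1] =
  flatten [seq self_delimit b.1 ++ b.2 | b <- B2] -> B1 = B2.
Proof.
elim: B1 B2 => [|[r1 l1] B1 IH] [|[r2 l2] B2] //=.
- by move=> _ _; case: r2.
- by move=> _ _; case: r1.
case/andP=> /eqP sz1 all1 /andP[/eqP sz2 all2].
rewrite -!(catA (self_delimit _)) => /self_delimit_inj[-> /eqP].
by rewrite eqseq_cat ?sz1 ?sz2 // => /andP[/eqP -> /eqP /IH ->].
Qed.

Definition inst_blocks (H : graph) (x : list_instance H) :=
  [seq ([seq adj v w | w <- enum (inst_graph x)],
        [seq z \in inst_list v | z <- enum H]) | v <- enum (inst_graph x)].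

Lemma inst_blocks_inj (H : graph) (x y : list_instance H) :
  inst_code x = inst_code y -> inst_blocks x = inst_blocks y.
Proof.
move=> exy; apply: (@blocks_inj #|H|).
- by apply/allP=> _ /mapP[v _ ->] /=; rewrite size_map -cardE.
- by apply/allP=> _ /mapP[v _ ->] /=; rewrite size_map -cardE.
by rewrite /inst_blocks -2!(map_comp _ _ (enum (inst_graph _))); exact: exy.
Qed.

Lemma inst_code_renaming (H : graph) (x y : list_instance H) :
  inst_code x = inst_code y ->
  exists phi : inst_graph x -> inst_graph y,
    [/\ bijective phi, forall u v, adj (phi u) (phi v) = adj u v
      & forall v, inst_list (phi v) = inst_list v].
Proof.
move/inst_blocks_inj => exy.
have sz : #|inst_graph x| = #|inst_graph y|.
  by rewrite !cardE; move/(congr1 size): exy; rewrite !size_map.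
pose phi v := enum_val (cast_ord sz (enum_rank v)) : inst_graph y.
pose psi v := enum_val (cast_ord (esym sz) (enum_rank v)) : inst_graph x.
have block v :
    ([seq adj (phi v) w | w <- enum (inst_graph y)],
     [seq z \in inst_list (phi v) | z <- enum H]) =
    ([seq adj v w | w <- enum (inst_graph x)],
     [seq z \in inst_list v | z <- enum H]).
  have := congr1 (fun B => nth ([::], [::]) B (enum_rank v)) exy.
  rewrite (nth_map v) -?cardE ?ltn_ord // (nth_map (phi v)); last first.
    by rewrite -cardE -sz ltn_ord.
  rewrite nth_enum_rank => ->.
  by rewrite {1 2}/phi (enum_val_nth (phi v)).
exists phi; split.
- exists psi => v.
    by rewrite /psi /phi enum_valK cast_ordK enum_rankK.
  by rewrite /psi /phi enum_valK cast_ordKV enum_rankK.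
- move=> u v; case: (block u) => + _ => /(congr1 (fun s => nth false s (enum_rank v))).
  rewrite (nth_map (phi v)) -?cardE -?sz ?ltn_ord // (nth_map v) -?cardE ?ltn_ord //.
  by rewrite nth_enum_rank => <-; rewrite {2}/phi (enum_val_nth (phi v)).
move=> v; case: (block v) => _ /eq_in_map e; apply/setP=> z.
by rewrite e ?mem_enum.
Qed.

Lemma num_list_hom_code_le (H : graph) (x y : list_instance H) :
  inst_code x = inst_code y -> num_list_hom y <= num_list_hom x.
Proof.
case/inst_code_renaming => phi [[psi phiK psiK] adjE listE].
pose F (h : {ffun inst_graph y -> H}) := [ffun v => h (phi v)].
have F_inj : injective F.
  by move=> h1 h2 /ffunP e; apply/ffunP=> v; have := e (psi v); rewrite !ffunE psiK.
rewrite /num_list_hom -(card_imset _ F_inj).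
apply/subset_leq_card/subsetP=> _ /imsetP[h + ->]; rewrite !inE.
case/andP=> /forallP hom /forallP lst; apply/andP; split.
  apply/forallP=> u; apply/forallP=> v; rewrite !ffunE -adjE.
  by have /forallP := hom (phi u).
by apply/forallP=> v; rewrite ffunE -listE.
Qed.

Lemma LHom_encode (H : graph) (x y : instance (LHom H)) :
  encode x = encode y -> answer x = answer y.
Proof.
by move=> e; apply/eqP; rewrite eqn_leq !num_list_hom_code_le.
Qed.

(* Main.v *)
(** By inclusion-exclusion, the number of surjective list homomorphisms is the
    sum over all subsets T of V(H) of (-1)^|V(H) - T| times the number of list
    homomorphisms for the lists S_v :&: T.  As H is fixed, the number of
    subsets T is constant, so a machine can query them one after the other.

    The heads of the machine move in unison along the n + 1 cells that carry
    the input and the blank after it.  In round k a sweep to the right parses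
    the input, writes on the oracle tape the code with the lists restricted to
    the k-th subset and, at the same time, adds to the output tape or subtracts
    from it the previous answer of the oracle, which it overwrites.  The sweep
    back removes leading zeros from the output, and then the oracle is called.
    The arithmetic is modulo 2^(n+1), which exceeds all the numbers of
    homomorphisms, so negative intermediate results are harmless. *)

From mathcomp Require Import all_boot all_order all_algebra.
From mathcomp Require Import zify ring.
Require Import Defs.

Set Implicit Arguments.
Unset Strict Implicit.
Unset Printing Implicit Defensive.

Import GRing.Theory Num.Theory.

(** * Binary arithmetic *)

Lemma binary_rec_fuel k n : n <= k -> binary_rec k n = binary n.
Proof.
rewrite /binary; elim/ltn_ind: n k => n IH [|k] lenk /=.
  by move: lenk; rewrite leqn0 => /eqP->.
case: n IH lenk => [//|n] IH lenk /=.
by rewrite IH ?[in RHS]IH //; lia.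
Qed.

Lemma binaryE n : binary n = if n == 0 then [::] else odd n :: binary n./2.
Proof.
case: n => [//|n]; rewrite {1}/binary [in LHS]/= -[uphalf n]/(n.+1./2).
by rewrite binary_rec_fuel //; lia.
Qed.

Definition bits_value (d : nat -> bool) (N : nat) : nat :=
  \sum_(i < N) d i * 2 ^ i.

Lemma bits_valueS d N :
  bits_value d N.+1 = d 0 + (bits_value (d \o S) N).*2.
Proof.
rewrite /bits_value big_ord_recl /= expn0 muln1; congr addn.
by rewrite -muln2 big_distrl; apply: eq_bigr => i _ /=; rewrite expnSr mulnA.
Qed.

Lemma bits_value_lt d N : bits_value d N < 2 ^ N.
Proof.
elim: N d => [|N IH] d; first by rewrite /bits_value big_ord0.
by rewrite bits_valueS expnS; have := IH (d \o S); case: (d 0); lia.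
Qed.

Lemma eq_bits_value d d' N :
  (forall i, i < N -> d i = d' i) -> bits_value d N = bits_value d' N.
Proof. by move=> e; apply: eq_bigr => i _; rewrite e. Qed.

Lemma bits_value0 d N : (forall i, d i = false) -> bits_value d N = 0.
Proof. by move=> d0; rewrite /bits_value big1 // => i _; rewrite d0. Qed.

Lemma bits_value_binary a N :
  a < 2 ^ N -> bits_value (nth false (binary a)) N = a.
Proof.
elim: N a => [|N IH] a.
  by rewrite ltnS leqn0 /bits_value big_ord0 => /eqP->.
rewrite expnS => ltaN; rewrite bits_valueS binaryE; case: eqP => [->|_] /=.
  by rewrite bits_value0 // => i; case: i.
by rewrite (eq_bits_value (d' := nth false (binary a./2))) // IH; lia.
Qed.

Lemma size_binary_le a N : a < 2 ^ N -> size (binary a) <= N.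
Proof.
elim: N a => [|N IH] a; first by rewrite ltnS leqn0 => /eqP->.
rewrite expnS => ltaN; rewrite binaryE; case: eqP => //= _.
by rewrite ltnS IH //; lia.
Qed.

Definition nonzero_from (d : nat -> bool) (N i : nat) : bool :=
  has d (iota i (N - i)).

Definition trim (d : nat -> bool) (N i : nat) : cell :=
  if nonzero_from d N i then Some (d i) else None.

Lemma has_bits_value d N : has d (iota 0 N) = (bits_value d N != 0).
Proof.
elim: N d => [|N IH] d; first by rewrite /bits_value big_ord0.
rewrite bits_valueS /= (iotaDl 1 0) has_map.
by rewrite (eq_has (a2 := d \o S)) // IH; case: (d 0); lia.
Qed.

Lemma nonzero_fromS d N i :
  nonzero_from d N.+1 i.+1 = nonzero_from (d \o S) N i.
Proof.
rewrite /nonzero_from subSS -(addn1 i) addnC iotaDl has_map.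
exact: eq_has.
Qed.

Lemma pmap_trim d N : pmap id (mkseq (trim d N) N) = binary (bits_value d N).
Proof.
elim: N d => [|N IH] d; first by rewrite /bits_value big_ord0.
have -> : mkseq (trim d N.+1) N.+1 =
          trim d N.+1 0 :: mkseq (trim (d \o S) N) N.
  rewrite /mkseq /= (iotaDl 1 0) -map_comp; congr cons; apply: eq_map => i /=.
  by rewrite /trim nonzero_fromS.
rewrite /= IH bits_valueS [in RHS]binaryE {1}/trim /nonzero_from subn0.
rewrite has_bits_value bits_valueS.
case: eqP => [e0|_] /=; last first.
  by rewrite oddD odd_double half_bit_double addbF oddb.
by have -> : bits_value (d \o S) N = 0 by lia.
Qed.

Lemma nonzero_from_step d N i :
  i < N -> nonzero_from d N i = nonzero_from d N i.+1 || d i.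
Proof. by move=> ltiN; rewrite /nonzero_from -(subnSK ltiN) /= orbC. Qed.

Lemma trim_true d N i : i < N -> (trim d N i == Some true) = d i.
Proof.
move=> ltiN; rewrite /trim nonzero_from_step //.
by case: (d i); rewrite ?orbT //; case: ifP.
Qed.

(* Carry of an addition, or borrow of a subtraction when [neg] holds. *)
Definition carry_next (neg a y c : bool) : bool :=
  [|| (a (+) neg) && y, (a (+) neg) && c | y && c].

Fixpoint carry (neg : bool) (a y : nat -> bool) (j : nat) : bool :=
  if j is i.+1 then carry_next neg (a i) (y i) (carry neg a y i) else false.

Definition sum_bit (neg : bool) (a y : nat -> bool) (j : nat) : bool :=
  a j (+) y j (+) carry neg a y j.

(** Only the carry out of the top digit is lost, so the digitwise result is right modulo [2 ^ N].
    Under [neg] the lost borrow counts negatively. *)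
Lemma sum_bits_value (neg : bool) a y N :
  ((bits_value a N)%:Z + (-1) ^+ neg * (bits_value y N)%:Z
  = (bits_value (sum_bit neg a y) N)%:Z
    + (-1) ^+ neg * (carry neg a y N * 2 ^ N)%N%:Z)%R.
Proof.
elim: N => [|N IH]; first by rewrite /bits_value !big_ord0 mulr0.
have E d : bits_value d N.+1 = (bits_value d N + d N * 2 ^ N)%N.
  by rewrite /bits_value big_ord_recr.
rewrite !E expnS /= {2}/sum_bit; move: IH.
move: (bits_value _ _) (bits_value _ _) (bits_value _ _) (2 ^ N)%N => A Y D P.
rewrite /carry_next.
case: neg (a N) (y N) (carry _ _ _ _) => [] [] [] [] /=;
  by rewrite ?expr0 ?expr1; lia.
Qed.

(** * Tapes *)

(* The head of t is on cell p.  Cells are numbered so that a string that is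
   read or written starts in cell 1; cell 0 is a blank that stops the sweeps
   to the left. *)
Definition represents (t : tape) (p : nat) (c : nat -> cell) : Prop :=
  (forall j, nth None (tright t) j = c (p + j)) /\
  (forall j, nth None (tleft t) j = if j < p then c (p - j.+1) else None).

Definition upd (c : nat -> cell) (p : nat) (a : cell) : nat -> cell :=
  fun j => if j == p then a else c j.

Definition cells (s : seq bool) : nat -> cell := nth None (None :: map Some s).

(** The shift is due to strings starting in cell 1. A blank counts as 0, so trimmed numbers need no
    padding. *)
Definition digit (c : nat -> cell) (i : nat) : bool := c i.+1 == Some true.

Lemma cells_out s j : size s < j -> cells s j = None.
Proof. by case: j => [//|j] szs; rewrite /cells /= nth_default // size_map. Qed.

Lemma cellsS s j : j < size s -> cells s j.+1 = Some (nth false s j).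
Proof. by move=> szs; rewrite /cells /= (nth_map false). Qed.

Lemma digit_cells s : digit (cells s) =1 nth false s.
Proof.
move=> j; rewrite /digit; case: (ltnP j (size s)) => szj.
  by rewrite cellsS // (inj_eq Some_inj) eqb_id.
by rewrite cells_out // nth_default.
Qed.

Lemma eq_represents t p c c' :
  c =1 c' -> represents t p c -> represents t p c'.
Proof.
by move=> e [hr hl]; split=> j; rewrite ?hr ?hl e.
Qed.

Lemma represents_tape_of s : represents (tape_of s) 1 (cells s).
Proof. by split=> j; rewrite ?add1n //= nth_nil; case: j. Qed.

Lemma represents_read t p c : represents t p c -> tread t = c p.
Proof. by case=> hr _; rewrite /tread -nth0 hr addn0. Qed.

Lemma represents_write t p c a :
  represents t p c -> represents (twrite a t) p (upd c p a).
Proof.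
case=> hr hl; split=> j /=; rewrite /upd.
  case: j => [|j] /=; first by rewrite addn0 eqxx.
  by rewrite nth_behead hr ifF //; lia.
by rewrite hl; case: ltnP => // ltjp; rewrite ifF //; lia.
Qed.

Lemma represents_right t p c :
  represents t p c -> represents (tmove MoveRight t) p.+1 c.
Proof.
move=> rep; have [hr hl] := rep; split=> j /=.
  by rewrite nth_behead hr addnS.
by case: j => [|j] /=; rewrite ?(represents_read rep) ?subn1 //= hl subSS.
Qed.

Lemma represents_left t p c :
  represents t p.+1 c -> represents (tmove MoveLeft t) p c.
Proof.
move=> rep; have [hr hl] := rep; split=> j /=.
  by case: j => [|j] /=; rewrite ?hr ?addSnnS // -nth0 hl subn1 addn0.
by rewrite nth_behead hl subSS ltnS.
Qed.

Lemma pmap_mkseq_nth (s : seq cell) N :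
  size s <= N -> pmap id (mkseq (nth None s) N) = pmap id s.
Proof.
elim: N s => [|N IH] [|a s] //=.
  by move=> _; elim: (iota _ _) => //= i l ->; rewrite nth_nil.
move=> szs; rewrite -[in RHS](IH s) // /mkseq /= (iotaDl 1 0) -map_comp.
by case: a.
Qed.

Lemma pmap_blank (c : nat -> cell) i k :
  (forall j, i <= j -> c j = None) -> pmap id [seq c j | j <- iota i k] = [::].
Proof.
elim: k i => //= k IH i ci; rewrite ci // IH // => j /ltnW; exact: ci.
Qed.

Lemma contents_represents t p c N :
  represents t p c -> (forall j, N <= j -> c j = None) ->
  contents t = pmap id (mkseq c N).
Proof.
case=> hr hl cN; rewrite /contents pmap_cat.
(* Large enough that both halves of the tape, padded with blanks, cover all listed cells and the
   first [N] cells. *)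
pose K := size (tright t) + size (tleft t) + N.
have ext : pmap id (mkseq c N) = pmap id (mkseq c (p + K)).
  have -> : p + K = N + (p + K - N) by lia.
  rewrite /mkseq iotaD map_cat pmap_cat add0n -[LHS]cats0; congr cat.
  by rewrite pmap_blank.
rewrite ext /mkseq iotaD map_cat pmap_cat; congr cat; last first.
  rewrite -(@pmap_mkseq_nth _ K) /K; last by lia.
  rewrite add0n -[X in iota X _]addn0 iotaDl -map_comp; congr (pmap id _).
  by apply: eq_map => i /=; rewrite hr.
have pmap_rev (s : seq cell) : pmap id (rev s) = rev (pmap id s).
  elim: s => // a s IH; rewrite rev_cons -cats1 pmap_cat IH /=.
  by case: a => [b|] /=; rewrite ?cats0 // rev_cons cats1.
rewrite pmap_rev -(@pmap_mkseq_nth _ (p + K)) /K; last by lia.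
rewrite -pmap_rev /mkseq iotaD map_cat rev_cat pmap_cat.
have -> : pmap id (rev [seq nth None (tleft t) i | i <- iota (0 + p) K]) = [::].
  by rewrite pmap_rev pmap_blank // => j; rewrite add0n hl ltnNge => ->.
congr (pmap id _); apply: (@eq_from_nth _ None).
  by rewrite size_rev !size_map.
move=> i; rewrite size_rev size_map size_iota => ltip.
rewrite nth_rev size_map size_iota // !(nth_map 0) ?size_iota //; last by lia.
by rewrite !nth_iota ?hl //; [rewrite ifT; [congr c|]|]; lia.
Qed.

(** One position [p] serves all tapes, since the heads move in unison. *)
Definition rep (M : oracle_machine) (C : config M) (q : om_state M) (p : nat)
    (c : om_tape M -> nat -> cell) : Prop :=
  cstate C = q /\ forall i, represents (ctapes C i) p (c i).

Lemma eq_rep (M : oracle_machine) (C : config M) q p c c' :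
  (forall i, c i =1 c' i) -> rep C q p c -> rep C q p c'.
Proof. by move=> e [qC tC]; split=> // i; apply: eq_represents (tC i). Qed.

Lemma rep_step (M : oracle_machine) f (C : config M) q p c q' a m p' c' :
  rep C q p c -> ~~ om_halt q -> om_query q = None ->
  om_trans q [ffun i => c i p] = (q', [ffun i => (a i, m)]) ->
  (m = MoveRight /\ p' = p.+1) \/ (m = MoveLeft /\ p = p'.+1) ->
  (forall i, upd (c i) p (a i) =1 c' i) -> rep (step f C) q' p' c'.
Proof.
case=> qC tC nhalt nquery trans mp cE; apply: eq_rep cE _.
rewrite /step qC (negPf nhalt) nquery.
have -> : [ffun i => tread (ctapes C i)] = [ffun i => c i p].
  by apply/ffunP=> i; rewrite !ffunE (represents_read (tC i)).
rewrite trans; split=> //= i; rewrite !ffunE /=.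
have := represents_write (a i) (tC i).
case: mp => [[-> ->]|[-> ->]]; first exact: represents_right.
exact: represents_left.
Qed.

(** * The machine *)

(* State 0 expects the flag of [self_delimit], state 1 the bit announced by a
   flag, state i.+2 the i-th bit of a list.  [inord] maps an index that is out
   of range to 0, so after the last bit of a list the parser is back in
   state 0. *)
Definition parse_next (q : nat) (ps : 'I_q.+2) (b : bool) : 'I_q.+2 :=
  match val ps with
  | 0 => if b then inord 1 else inord 2
  | 1 => ord0
  | i.+2 => inord i.+3
  end.

(** * Restricting the lists inside the code of an instance *)

Definition mask_bit (H : graph) (T : {set H}) (ps : 'I_#|H|.+2) (b : bool) :=
  if val ps is i.+2 then b && nth false [seq z \in T | z <- enum H] i else b.

Fixpoint mask_code (H : graph) (T : {set H}) (ps : 'I_#|H|.+2) (s : seq bool) :=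
  if s is b :: s' then mask_bit T ps b :: mask_code T (parse_next ps b) s'
  else [::].

Lemma size_mask_code (H : graph) (T : {set H}) ps s :
  size (mask_code T ps s) = size s.
Proof. by elim: s ps => //= b s IH ps; rewrite IH. Qed.

Lemma nth_mask_code (H : graph) (T : {set H}) ps s j : j < size s ->
  nth false (mask_code T ps s) j =
  mask_bit T (foldl (@parse_next _) ps (take j s)) (nth false s j).
Proof.
elim: s ps j => // b s IH ps [|j] //= szj.
by rewrite IH.
Qed.

Lemma mask_code_self_delimit (H : graph) (T : {set H}) r t :
  mask_code T ord0 (self_delimit r ++ t) =
  self_delimit r ++ mask_code T (inord 2) t.
Proof.
elim: r => [//|b r IH].
have E u : self_delimit (b :: r) ++ u = [:: true, b & self_delimit r ++ u].
  by [].
have E1 : val (inord 1 : 'I_#|H|.+2) = 1 by rewrite /= inordK.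
by rewrite !E /= /parse_next /= E1 IH /mask_bit E1.
Qed.

Lemma mask_code_list (H : graph) (T S : {set H}) t :
  mask_code T (inord 2) ([seq z \in S | z <- enum H] ++ t) =
  [seq z \in S :&: T | z <- enum H] ++ mask_code T ord0 t.
Proof.
have sz : size (enum H) = #|H| by rewrite cardE.
(* The induction needs the parser at an arbitrary position [i] of the list. *)
suff gen k i : i + k = #|H| ->
    mask_code T (inord i.+2) ([seq z \in S | z <- drop i (enum H)] ++ t) =
    [seq z \in S :&: T | z <- drop i (enum H)] ++ mask_code T ord0 t.
  by have := gen #|H| 0 (add0n _); rewrite drop0.
elim: k i => [|k IH] i ik.
  rewrite drop_oversize ?sz; last by lia.
  (* Now [i = #|H|], so [i.+2] is out of range and [inord] returns state 0. For empty [H] this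
     already happens to [inord 2]. *)
  congr mask_code; apply: val_inj.
  by rewrite /inord val_insubd ltnNge -ik addn0 leqnn.
have ltiH : i < #|H| by rewrite -ik addnS ltnS leq_addr.
have /card_gt0P[z0 _] : 0 < #|H| by apply: leq_ltn_trans ltiH.
have szi : i < size (enum H) by rewrite sz.
rewrite (drop_nth z0) //= {1}/mask_bit {1}/parse_next.
have -> : val (inord i.+2 : 'I_#|H|.+2) = i.+2 by rewrite /= inordK.
by rewrite IH ?addSnnS // (nth_map z0) ?sz // inE.
Qed.

Definition restrict_lists (H : graph) (x : list_instance H) (T : {set H}) :
    list_instance H :=
  ListInstance (@inst_irrefl H x) (fun v => inst_list v :&: T).

Lemma mask_inst_code (H : graph) (x : list_instance H) (T : {set H}) :
  mask_code T ord0 (inst_code x) = inst_code (restrict_lists x T).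
Proof.
rewrite /inst_code /=; elim: {2 4}(enum (inst_graph x)) => [//|v l IH].
have flat F : flatten (map F (v :: l)) = F v ++ flatten (map F l) :> seq bool.
  by [].
rewrite !flat -!(catA (self_delimit _)).
by rewrite mask_code_self_delimit mask_code_list IH.
Qed.

(** * The transition table *)

(** The default [set0] is met in the final round [num_subsets H], which adds the last answer and
    halts instead of asking. *)
Definition subset_at (H : graph) (k : nat) : {set H} :=
  nth set0 (enum {: {set H}}) k.

Definition num_subsets (H : graph) : nat := #|{: {set H}}|.

(** Finite for fixed [H]: a right sweep remembers round, parser state and carry; a left sweep
    remembers the round and whether a nonzero digit was seen. *)
Definition ie_state (H : graph) : finType :=
  ('I_(num_subsets H).+1 * 'I_#|H|.+2 * bool + 'I_(num_subsets H).+1 * bool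
   + 'I_(num_subsets H).+1)%type.

Definition go_right (H : graph) (k : 'I_(num_subsets H).+1)
    (ps : 'I_#|H|.+2) (c : bool) : ie_state H := inl (inl (k, ps, c)).
Definition go_left (H : graph) (k : 'I_(num_subsets H).+1) (seen : bool) :
    ie_state H := inl (inr (k, seen)).
Definition ask (H : graph) (k : 'I_(num_subsets H).+1) : ie_state H := inr k.

Definition on_tapes (X : Type) (inp out orc : X) (i : option bool) : X :=
  match i with None => inp | Some false => out | Some true => orc end.

(* The sign used in round k belongs to the answer obtained in round k - 1; in
   round 0 the oracle tape is empty, so the sign does not matter. *)
Definition ie_neg (H : graph) (k : nat) : bool :=
  odd #|~: subset_at H k.-1|.

(** A blank on the input tape ends each sweep. At the right end the top digit is written, blank if
    zero, the carry is dropped, and the oracle tape is cleared there, since an answer can be one bit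
    longer than the query. *)
Definition ie_trans (H : graph) (q : ie_state H)
    (r : {ffun option bool -> cell}) :
    ie_state H * {ffun option bool -> cell * move} :=
  let a := r (Some false) == Some true in
  let y := r (Some true) == Some true in
  match q with
  | inl (inl (k, ps, c)) =>
    let d := a (+) y (+) c in
    if r None is Some b then
      (go_right k (parse_next ps b) (carry_next (ie_neg H k) a y c),
       [ffun i => (on_tapes (Some b) (Some d)
                     (Some (mask_bit (subset_at H k) ps b)) i, MoveRight)])
    else
      (go_left k d,
       [ffun i => (on_tapes None (if d then Some true else None) None i,
                   MoveLeft)])
  | inl (inr (k, seen)) =>
    if r None is Some b then
      (go_left k (seen || a),
       [ffun i => (on_tapes (Some b) (if seen || a then Some a else None)
                     (r (Some true)) i, MoveLeft)])
    else (ask k, [ffun i => (r i, MoveRight)])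
  | inr _ => (q, [ffun i => (None, Stay)])
  end.

Definition ie_halt (H : graph) (q : ie_state H) : bool :=
  if q is inr k then k == ord_max else false.

Definition ie_query (H : graph) (q : ie_state H) : option (ie_state H) :=
  if q is inr k then Some (go_right (inord k.+1) ord0 false) else None.

Definition ie_machine (H : graph) : oracle_machine :=
  @OracleMachine (option bool) None (Some false) (Some true)
    (ie_state H) (go_right ord0 ord0 false)
    (@ie_halt H) (@ie_query H) (@ie_trans H).

(** * Sweeps and rounds *)

(** The output tape during the left sweep with the heads on cell [p]: only the cells to the right of
    [p] are trimmed. *)
Definition half_trimmed (n p : nat) (d : nat -> bool) (i : nat) : cell :=
  if 0 < i <= p then Some (d i.-1)
  else if p < i <= n.+1 then trim d n.+1 i.-1 else None.

(** Invariant of the right sweep: cells beyond [j] still hold the old accumulator and answer, so the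
    next digits are read unchanged. *)
Lemma ie_right (H : graph) f (C : config (ie_machine H))
    (k : 'I_(num_subsets H).+1) s ca co j :
  rep C (go_right k ord0 false) 1 (on_tapes (cells s) ca co) ->
  j <= size s ->
  rep (iter j (step f) C)
    (go_right k (foldl (@parse_next _) ord0 (take j s))
       (carry (ie_neg H k) (digit ca) (digit co) j)) j.+1
    (on_tapes (cells s)
       (fun i => if 0 < i <= j
                 then Some (sum_bit (ie_neg H k) (digit ca) (digit co) i.-1)
                 else ca i)
       (fun i => if 0 < i <= j
                 then cells (mask_code (subset_at H k) ord0 s) i else co i)).
Proof.
move=> rep0; elim: j => [|j IH] lejn.
  rewrite take0 /=; apply: eq_rep rep0 => -[[]|] i //=; by rewrite ifF //; lia.
set d := sum_bit _ _ _ in IH *; set w := mask_code _ _ _ in IH *.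
pose a := on_tapes (Some (nth false s j)) (Some (d j)) (Some (nth false w j)).
have szw : size w = size s by rewrite size_mask_code.
rewrite iterS; apply: (rep_step (M := ie_machine H) (a := a) (m := MoveRight)
          f (IH (ltnW lejn))) => //; [|by left|]; last first.
  case=> [[]|] i; rewrite /upd /a /=; case: (i =P j.+1) => [->|ne].
  - by rewrite leqnn cellsS // szw.
  - by congr (if _ then _ else _); lia.
  - by rewrite leqnn.
  - by congr (if _ then _ else _); lia.
  - by rewrite cellsS.
  - by [].
rewrite /= !ffunE /= (cellsS lejn) ltnn /=; congr pair.
  by rewrite (take_nth false lejn) foldl_rcons.
apply/ffunP=> i; rewrite !ffunE /a; congr pair.
by case: i => [[]|] //=; rewrite nth_mask_code.
Qed.

(** Used with [N = n.+1], the last cell visited in a round: a sweep could not clear symbols beyond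
    it. *)
Definition blank_outside (N : nat) (c : nat -> cell) : Prop :=
  c 0 = None /\ forall i, N < i -> c i = None.

Lemma blank_outside_cells N s : size s <= N -> blank_outside N (cells s).
Proof. by move=> szs; split=> // i ltNi; rewrite cells_out //; lia. Qed.

(** The step on the blank after the input yields digit [n] and drops the carry; here the reduction
    modulo [2 ^ n.+1] takes place. *)
Lemma ie_turn (H : graph) f (C : config (ie_machine H))
    (k : 'I_(num_subsets H).+1) s ca co :
  let n := size s in
  let d := sum_bit (ie_neg H k) (digit ca) (digit co) in
  rep C (go_right k ord0 false) 1 (on_tapes (cells s) ca co) ->
  blank_outside n.+1 ca -> blank_outside n.+1 co ->
  rep (iter n.+1 (step f) C) (go_left k (nonzero_from d n.+1 n)) n
    (on_tapes (cells s) (half_trimmed n n d)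
       (cells (mask_code (subset_at H k) ord0 s))).
Proof.
move=> n d rep0 [ca0 caN] [co0 coN].
have szw := size_mask_code (subset_at H k) ord0 s.
have nzn : nonzero_from d n.+1 n = d n.
  by rewrite /nonzero_from subSnn /= orbF.
pose a := on_tapes None (if d n then Some true else None : cell) (None : cell).
rewrite iterS; apply: (rep_step (M := ie_machine H) (a := a) (m := MoveLeft)
          f (ie_right f rep0 (leqnn n))) => //; [|by right|]; last first.
  case=> [[]|] i; rewrite /upd /a /=; case: (i =P n.+1) => [->|ne].
  - by rewrite cells_out ?szw.
  - case: ifP => // h; case: i h ne => [//|i] h ne.
    by rewrite coN ?cells_out ?szw //; lia.
  - by rewrite /half_trimmed /= ltnn leqnn /= /trim nzn; case: (d n).
  - rewrite /half_trimmed; case: ifP => // h; rewrite ifF; last by lia.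
    by case: i h ne => [//|i] h ne; rewrite caN //; lia.
  - by rewrite cells_out.
  - by [].
rewrite /= !ffunE /= cells_out // ltnn /=; congr pair.
by rewrite nzn.
Qed.

(** The bit in the state tells whether a digit to the right of the head is nonzero; with the scanned
    digit, this decides what [trim] writes. *)
Lemma ie_left (H : graph) f (C : config (ie_machine H))
    (k : 'I_(num_subsets H).+1) s d co j :
  let n := size s in
  rep C (go_left k (nonzero_from d n.+1 n)) n
    (on_tapes (cells s) (half_trimmed n n d) co) ->
  j <= n ->
  rep (iter j (step f) C) (go_left k (nonzero_from d n.+1 (n - j))) (n - j)
    (on_tapes (cells s) (half_trimmed n (n - j) d) co).
Proof.
move=> n rep0; elim: j => [|j IH] ltjn; first by rewrite subn0.
have := IH (ltnW ltjn); rewrite iterS -(subnSK ltjn).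
move: (n - j.+1) (leq_subr j.+1 n) (subnSK ltjn) => p lepn ep repj.
have ltpn : p < n by lia.
pose a := on_tapes (Some (nth false s p)) (trim d n.+1 p) (co p.+1).
apply: (rep_step (M := ie_machine H) (a := a) (m := MoveLeft) f repj) => //;
  [|by right|]; last first.
  case=> [[]|] i; rewrite /upd /a /=; case: (i =P p.+1) => [->|ne] //.
  - by rewrite /half_trimmed ltnn leqnn ltnS /= ltnW.
  - rewrite /half_trimmed.
    have -> : (0 < i <= p.+1) = (0 < i <= p) by lia.
    by have -> : (p.+1 < i <= n.+1) = (p < i <= n.+1) by lia.
  - by rewrite cellsS.
have ht : half_trimmed n p.+1 d p.+1 = Some (d p).
  by rewrite /half_trimmed leqnn.
rewrite /= !ffunE /= cellsS // ht (inj_eq Some_inj) eqb_id.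
rewrite -nonzero_from_step //; congr pair.
Qed.

Lemma ie_round (H : graph) f (C : config (ie_machine H))
    (k : 'I_(num_subsets H).+1) s ca co :
  let n := size s in
  let d := sum_bit (ie_neg H k) (digit ca) (digit co) in
  rep C (go_right k ord0 false) 1 (on_tapes (cells s) ca co) ->
  blank_outside n.+1 ca -> blank_outside n.+1 co ->
  rep (iter n.+1.*2 (step f) C) (ask k) 1
    (on_tapes (cells s) (half_trimmed n 0 d)
       (cells (mask_code (subset_at H k) ord0 s))).
Proof.
move=> n d rep0 caN coN.
have := ie_left f (ie_turn f rep0 caN coN) (leqnn n).
rewrite -/n -/d subnn -iterD => repn.
(* [n.+1] steps to the right, [n] to the left, and one from cell 0 back to cell 1. *)
rewrite (_ : n.+1.*2 = (n + n.+1).+1) ?iterS; last by lia.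
set c := on_tapes _ _ _ in repn *.
apply: (rep_step (M := ie_machine H) (a := fun i => c i 0) (m := MoveRight)
         f repn) => //; [|by left|].
  by rewrite /= !ffunE /=; congr pair; apply/ffunP=> i; rewrite !ffunE.
by move=> i j; rewrite /upd; case: eqP => // ->.
Qed.

Lemma contents_cells t p s : represents t p (cells s) -> contents t = s.
Proof.
move=> rept; rewrite (@contents_represents _ _ _ (size s).+1 rept); last first.
  by move=> j; exact: cells_out.
rewrite pmap_mkseq_nth /= ?size_map //.
by elim: s {rept} => //= b s ->.
Qed.

(** The oracle leaves the head on the first symbol of its answer, which is cell 1, so the heads stay
    aligned. *)
Lemma rep_ask (H : graph) f (C : config (ie_machine H))
    (k : 'I_(num_subsets H).+1) c w :
  rep C (ask k) 1 c -> c (Some true) = cells w -> k != ord_max ->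
  rep (step f C) (go_right (inord k.+1) ord0 false) 1
    (on_tapes (c None) (c (Some false)) (cells (f w))).
Proof.
case=> qC tC cw nmax; rewrite /step qC /= (negPf nmax).
split=> // i; rewrite ffunE; case: i => [[]|] /=; try exact: tC.
have := tC (Some true); rewrite cw => /contents_cells ->.
exact: represents_tape_of.
Qed.

(** * Bounds on the numbers of homomorphisms *)

Lemma size_inst_code (H : graph) (x : list_instance H) :
  #|H| * #|inst_graph x| <= size (inst_code x).
Proof.
rewrite /inst_code [#|inst_graph x|]cardE.
elim: {1 3}(enum (inst_graph x)) => [|v l IH]; first by rewrite muln0.
have flat F : flatten (map F (v :: l)) = F v ++ flatten (map F l) :> seq bool.
  by [].
rewrite mulnS flat.
by rewrite !size_cat size_map -cardE leq_add // leq_addl.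
Qed.

(** There are at most [#|H| ^ #|G|] maps, and [#|H| < 2 ^ #|H|], while the code spends [#|H|] bits
    on the list of each vertex. Hence every answer fits in [n.+1] digits. *)
Lemma num_list_hom_lt (H : graph) (x : list_instance H) :
  num_list_hom x < 2 ^ (size (inst_code x)).+1.
Proof.
apply: (@leq_ltn_trans (#|H| ^ #|inst_graph x|)).
  by rewrite -card_ffun; apply: max_card.
apply: (@leq_ltn_trans (2 ^ (size (inst_code x)))); last by rewrite ltn_exp2l.
apply: leq_trans (leq_pexp2l (isT : 0 < 2) (size_inst_code x)).
rewrite expnM; case: #|inst_graph x| => // n.
by rewrite leq_exp2r // ltnW // ltn_expl.
Qed.

Lemma num_list_surj_hom_le (H : graph) (x : list_instance H) :
  num_list_surj_hom x <= num_list_hom x.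
Proof.
apply/subset_leq_card/subsetP=> h; rewrite !inE.
by case/and3P=> -> ->.
Qed.

Local Open Scope ring_scope.

(** * Inclusion-exclusion *)

(* The product expands into a sum over the sets T, in which T contributes
   (-1)^|~: T| when T contains the image of h, and 0 otherwise. *)
Lemma surjective_signed_sum (G H : graph) (h : G -> H) :
  (surjectiveb h)%:R =
  \sum_(T : {set H}) (-1) ^+ #|~: T| * [forall v, h v \in T]%:R :> int.
Proof.
pose hit z := [exists v, h v == z].
transitivity (\prod_(z : H) (1 + (- (~~ hit z)%:R)) : int).
  rewrite /surjectiveb; case: forallP => [sur|nsur].
    by rewrite big1 // => z _; rewrite /hit sur subr0.
  have /forallPn[z nhit] : ~~ [forall z, hit z] by apply/forallP.
  by rewrite (bigD1 z) //= nhit subrr mul0r.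
rewrite bigA_distr; apply: eq_big => // T _.
case: forallP => [hT|nhT].
  rewrite mulr1 -prodr_const [RHS]big_mkcond /=; apply: eq_bigr => z _.
  rewrite inE; case: ifP => //= zT; rewrite [~~ _](_ : _ = true) //.
  by apply/existsPn=> v; apply: contraFN zT => /eqP <-.
have /forallPn[v nv] : ~~ [forall v, h v \in T] by apply/forallP.
rewrite (bigD1 (h v)) //= (negPf nv) /hit.
have -> : [exists w, h w == h v] by apply/existsP; exists v.
by rewrite oppr0 mul0r mulr0.
Qed.

(** Sum the signed expansion over all list homomorphisms and exchange the sums: having image in [T]
    amounts to respecting the lists cut down to [T]. *)
Lemma num_list_surj_hom_incl_excl (H : graph) (x : list_instance H) :
  (num_list_surj_hom x)%:Z =
  \sum_(T : {set H}) (-1) ^+ #|~: T| * (num_list_hom (restrict_lists x T))%:Z.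
Proof.
pose good (h : {ffun inst_graph x -> H}) :=
  is_hom h && respects (@inst_list H x) h.
have cardE' (P : pred {ffun inst_graph x -> H}) :
    #|[set h | P h]|%:Z = \sum_h (P h)%:R.
  rewrite -natz -sum1_card natr_sum big_mkcond; apply: eq_bigr => h _.
  by rewrite inE; case: (P h).
rewrite /num_list_surj_hom cardE'.
transitivity (\sum_h \sum_(T : {set H})
   (-1) ^+ #|~: T| * (good h && [forall v, h v \in T])%:R : int).
  apply: eq_bigr => h _; rewrite andbA -/(good h).
  case: (good h) => /=; first exact: surjective_signed_sum.
  by rewrite big1 // => T _; rewrite mulr0.
rewrite exchange_big; apply: eq_bigr => T _ /=.
rewrite /num_list_hom cardE' big_distrr; apply: eq_bigr => h _ /=.
rewrite /good -andbA; congr (_ * (nat_of_bool (_ && _))%:R).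
apply/andP/forallP => [[/forallP hS /forallP hT] v|hST].
  by rewrite inE hS hT.
by split; apply/forallP=> v; have := hST v; rewrite inE => /andP[].
Qed.

Lemma incl_excl_subset_at (H : graph) (x : list_instance H) :
  (num_list_surj_hom x)%:Z =
  \sum_(i < num_subsets H) (-1) ^+ odd #|~: subset_at H i|
    * (num_list_hom (restrict_lists x (subset_at H i)))%:Z.
Proof.
rewrite num_list_surj_hom_incl_excl -big_enum (big_nth set0) big_mkord -cardE.
by apply: eq_bigr => i _; rewrite signr_odd.
Qed.

(** * Correctness *)

Definition accumulator (n : nat) (c : nat -> cell) : int :=
  (bits_value (digit c) n.+1)%:Z.

Lemma digit_half_trimmed n d i :
  (i <= n)%N -> digit (half_trimmed n 0 d) i = d i.
Proof.
move=> lein; rewrite /digit /half_trimmed andbF !ltnS lein /=.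
exact: trim_true.
Qed.

Lemma accumulator_half_trimmed n d :
  accumulator n (half_trimmed n 0 d) = (bits_value d n.+1)%:Z.
Proof.
congr Posz; apply: eq_bits_value => i; rewrite ltnS.
exact: digit_half_trimmed.
Qed.

Lemma blank_outside_half_trimmed n d :
  blank_outside n.+1 (half_trimmed n 0 d).
Proof.
split=> [//|[//|i] lti]; rewrite /half_trimmed andbF ifF //.
by rewrite [(i < n.+1)%N]leqNgt lti andbF.
Qed.

Lemma contents_half_trimmed t n d :
  represents t 1 (half_trimmed n 0 d) ->
  contents t = binary (bits_value d n.+1).
Proof.
move=> rept; rewrite (@contents_represents _ _ _ n.+2 rept); last first.
  by case: (blank_outside_half_trimmed n d).
have -> : mkseq (half_trimmed n 0 d) n.+2 = None :: mkseq (trim d n.+1) n.+1.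
  rewrite /mkseq -[iota 0 n.+2]/(0%N :: iota 1 n.+1) map_cons (iotaDl 1 0).
  rewrite -map_comp; congr cons; apply/eq_in_map => i.
  by rewrite mem_iota /half_trimmed /= => ->.
by rewrite -pmap_trim.
Qed.

(** Invariant between rounds: the accumulator plus the signed answer still pending on the oracle
    tape is the partial sum modulo [2 ^ n.+1]. Each round costs [n.+1.*2] steps and one query. *)
Lemma ie_run (H : graph) f (x : list_instance H) (k : nat) :
  let s := inst_code x in
  let n := size s in
  solves f (LHom H) -> (k <= num_subsets H)%N ->
  exists ca co (z : int),
  [/\ rep (iter (k * n.+1.*2.+1) (step f) (init (ie_machine H) s))
        (go_right (inord k) ord0 false) 1 (on_tapes (cells s) ca co),
      blank_outside n.+1 ca, blank_outside n.+1 co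
    & accumulator n ca + (-1) ^+ ie_neg H k * accumulator n co =
      \sum_(i < k) (-1) ^+ odd #|~: subset_at H i|
        * (num_list_hom (restrict_lists x (subset_at H i)))%:Z
      + z * (2 ^ n.+1)%N%:Z].
Proof.
move=> s n sol; elim: k => [|k IH] lek.
  exists (cells [::]), (cells [::]), 0.
  have acc0 : accumulator n (cells [::]) = 0.
    rewrite /accumulator bits_value0 // => i.
    by rewrite digit_cells nth_nil.
  split; try exact: blank_outside_cells; last first.
    by rewrite big_ord0 acc0 mulr0 mul0r.
  have -> : inord 0 = ord0 :> 'I_(num_subsets H).+1.
    by apply: val_inj; exact: inordK.
  split=> // i.
  by rewrite /= ffunE; case: i => [[]|]; exact: represents_tape_of.
have [ca [co [z [repk caN coN acc]]]] := IH (ltnW lek).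
have kK : (inord k : 'I_(num_subsets H).+1) = k :> nat.
  by rewrite inordK // ltnW.
have := ie_round f repk caN coN; set d := sum_bit _ _ _ => repq.
rewrite mask_inst_code in repq; set y := restrict_lists _ _ in repq.
have nmax : (inord k : 'I_(num_subsets H).+1) != ord_max.
  by apply/eqP=> /(congr1 val) /= e; move: lek; rewrite -{1}kK e ltnn.
have := rep_ask f repq erefl nmax; rewrite -iterS -iterD /= -/n kK.
have -> : f (inst_code y) = binary (num_list_hom y) by exact: sol.
move=> repS.
exists (half_trimmed n 0 d), (cells (binary (num_list_hom y))).
(* The multiple of the modulus changes by the carry dropped in this round. *)
exists (z - (-1) ^+ ie_neg H k
  * (carry (ie_neg H k) (digit ca) (digit co) n.+1)%:Z).
have szy : size (inst_code y) = n by rewrite -mask_inst_code size_mask_code.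
have lty := num_list_hom_lt y; rewrite szy in lty.
split.
- exact: repS.
- exact: blank_outside_half_trimmed.
- by apply: blank_outside_cells; exact: size_binary_le.
rewrite accumulator_half_trimmed {1}/accumulator.
rewrite (eq_bits_value (fun i _ => digit_cells _ i)) bits_value_binary //.
have := sum_bits_value (ie_neg H k) (digit ca) (digit co) n.+1.
rewrite -/(accumulator n ca) -/(accumulator n co) acc big_ord_recr /=.
rewrite {4}/ie_neg /= /y /d kK PoszM.
move: (\sum_(i < k) _) (bits_value _ _) => S V E.
have -> : V%:Z = S + z * (2 ^ n.+1)%N%:Z - (-1) ^+ ie_neg H k *
    ((carry (ie_neg H k) (digit ca) (digit co) n.+1)%:Z * (2 ^ n.+1)%N%:Z).
  by rewrite E addrK.
move: (num_list_hom _)%:Z (2 ^ n.+1)%N%:Z (carry _ _ _ _)%:Z => N P c.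
by move: (_ ^+ ie_neg H k) (_ ^+ odd _) => e1 e2; ring.
Qed.

Theorem theorem4p1 (H : graph) : LSHom H <=T LHom H.
Proof.
pose m := num_subsets H.
(* There are [m.+1] rounds of [n.+1.*2] steps each, and [m] queries. *)
exists (ie_machine H), (Poly [:: m.+1.*2 + m; m.+1.*2]%N) => f sol x.
rewrite /= in x *; set s := inst_code x; set n := size s.
have [ca [co [z [repm caN coN acc]]]] := ie_run x sol (leqnn m).
(* The extra round absorbs the last pending answer. *)
have := ie_round f repm caN coN; set d := sum_bit _ _ _ => repq.
rewrite -iterD -/s -/n in repq.
have time : (Poly [:: m.+1.*2 + m; m.+1.*2]%N).[n] =
    (n.+1.*2 + m * n.+1.*2.+1)%N.
  by rewrite horner_Poly /=; lia.
rewrite /outputs_within time; case: repq => qC tC; split.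
  by rewrite qC /= -(inj_eq val_inj) /= inordK.
rewrite (contents_half_trimmed (tC (Some false))); congr binary.
have := sum_bits_value (ie_neg H m) (digit ca) (digit co) n.+1.
rewrite -/(accumulator n ca) -/(accumulator n co) acc -incl_excl_subset_at.
have mK : (inord m : 'I_m.+1) = m :> nat by rewrite inordK.
rewrite -/s -/n /d mK.
have ltd := bits_value_lt (sum_bit (ie_neg H m) (digit ca) (digit co)) n.+1.
have ltx : (num_list_surj_hom x < 2 ^ n.+1)%N.
  exact: leq_ltn_trans (num_list_surj_hom_le x) (num_list_hom_lt x).
move: ltd ltx; move: (bits_value _ _) (carry _ _ _ _) => V c ltd ltx E.
have [w Ew] : exists w : int,
    V%:Z = (num_list_surj_hom x)%:Z + w * (2 ^ n.+1)%N%:Z.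
  exists (z - (-1) ^+ ie_neg H m * c%:Z).
  by rewrite mulrBl -mulrA -PoszM addrA E addrK.
(* Both numbers lie below the modulus, so congruence gives equality. *)
have := congr1 (fun u => (u %% (2 ^ n.+1)%N)%Z) Ew.
by rewrite addrC modzMDl !modz_nat !modn_small // => -[].
Qed.
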